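(* Let $G$ be a connected finite simple $d$-regular graph ($d\ge2$) with $n$ vertices and $m$ edges, and let ${\bf U}$ be the transition probability matrix of the correlated random walk on $G$ with respect to the $d\times d$ matrix $\frac1d{\bf J}_d$. Then $$\det(\lambda{\bf I}_{2m}-{\bf U})=\lambda^{2m-n}\det\left(\lambda{\bf I}_n-\frac1d{\bf A}(G)\right),$$ where ${\bf A}(G)$ is the adjacency matrix of $G$.
   Context: For a finite simple graph $G$, $D(G)=\{(u,v),(v,u)\mid uv\in E(G)\}$ is its set of arcs; for $e=(u,v)\in D(G)$ write $o(e)=u$, $t(e)=v$. ${\bf J}_d$ is the $d\times d$ all-ones matrix. The transition probability matrix of the correlated random walk on the $d$-regular graph $G$ with respect to $\frac1d{\bf J}_d$ is the $2m\times 2m$ matrix ${\bf U}=(U_{ef})_{e,f\in D(G)}$ with $U_{ef}=1/d$ if $t(e)=o(f)$ and $U_{ef}=0$ otherwise. *)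

(* Defs.v *)
From HB Require Import structures.
From mathcomp Require Import all_boot all_order all_algebra.

Set Implicit Arguments.
Unset Strict Implicit.
Unset Printing Implicit Defensive.

Import GRing.Theory.
Local Open Scope ring_scope.

Record sgraph := SGraph {
  vertex :> finType;
  adj : rel vertex;
  adj_sym : symmetric adj;
  adj_irrefl : irreflexive adj
}.

Section Graph.
Variable G : sgraph.

Definition edges : {set {set G}} :=
  [set [set p.1; p.2] | p : G * G & adj p.1 p.2].

Definition arcs : {set G * G} := [set p : G * G | adj p.1 p.2].

(* The graph with no vertex is not connected. *)
Definition connected : Prop :=
  (0 < #|G|)%N /\ forall x y : G, connect (@adj G) x y.

Definition regular (d : nat) : Prop :=
  forall x : G, #|[set y | adj x y]| = d.

End Graph.

Definition arc_origin (G : sgraph) (e : G * G) : G := e.1.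
Definition arc_terminus (G : sgraph) (e : G * G) : G := e.2.

(* Rows and columns are indexed by vertices or arcs through their canonical
   enumeration [enum_val]; determinants do not depend on this choice. *)
Definition adjacency_mx (R : nzRingType) (G : sgraph) : 'M[R]_#|G| :=
  \matrix_(i, j) (adj (enum_val i : G) (enum_val j))%:R.

(* The entry d^-1 is the common entry of the d x d matrix (1/d) J_d. *)
Definition crw_mx (R : fieldType) (G : sgraph) (d : nat) : 'M[R]_#|arcs G| :=
  \matrix_(i, j)
    if arc_terminus (enum_val i) == arc_origin (enum_val j)
    then d%:R^-1 else 0.

(* Main.v *)
Require Import Defs.
From HB Require Import structures.
From mathcomp Require Import all_boot all_order all_algebra.

Import GRing.Theory.
Local Open Scope ring_scope.

(** The matrix U depends on an arc e only through its terminus and on an arc f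
    only through its origin, so it factors through the vertices: U = (1/d) T O,
    where T records the terminus of each arc and O the origin. Multiplied in
    the other order, O T counts the arcs from one vertex to another, which in a
    simple graph is the adjacency matrix A. The theorem is thus an instance of
    Sylvester's identity ([char_poly_mulmxC]): for B of size p x q and C of size
    q x p with q <= p, the characteristic polynomials of B C and C B differ
    only by the factor 'X^(p - q). Here p is the number of arcs, equal to 2m
    because every edge carries two arcs ([card_arcs_edges]), and q = n.
    Regularity gives p = n d >= n ([card_arcs_regular]).

    Sylvester's identity is proved for polynomials rather than for a fixed
    lambda, because 'X can be cancelled whereas lambda may be 0. *)

(** Both sides come from the block matrix M with rows (a, B) and (C, 1).
    Clearing its lower left block gives det M = det (a - B C); clearing its
    upper right block, which costs a factor a ^+ q since a need not be
    invertible, gives a ^+ p * det (a - C B). *)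
Lemma det_scalar_sub_mulmxC (R : comNzRingType) (p q : nat) (a : R)
    (B : 'M[R]_(p, q)) (C : 'M[R]_(q, p)) :
  a ^+ q * \det (a%:M - B *m C) = a ^+ p * \det (a%:M - C *m B).
Proof.
pose M := block_mx a%:M B C 1%:M.
have detM : \det M = \det (a%:M - B *m C).
  have : M *m block_mx 1%:M 0 (- C) 1%:M = block_mx (a%:M - B *m C) B 0 1%:M.
    by rewrite mulmx_block !mulmx1 !mul1mx !mulmx0 !add0r mulmxN subrr.
  move/(congr1 determinant).
  by rewrite det_mulmx det_lblock det_ublock !det1 !mulr1.
have : M *m block_mx 1%:M (- B) 0 a%:M = block_mx a%:M 0 C (a%:M - C *m B).
  rewrite mulmx_block !mulmx1 !mul1mx !mulmx0 !addr0 !mulmxN.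
  by rewrite mul_scalar_mx mul_mx_scalar addNr addrC.
move/(congr1 determinant).
by rewrite det_mulmx det_ublock det_lblock det1 mul1r !det_scalar detM mulrC.
Qed.

Lemma char_poly_mulmxC (R : comNzRingType) (p q : nat)
    (B : 'M[R]_(p, q)) (C : 'M[R]_(q, p)) : (q <= p)%N ->
  char_poly (B *m C) = 'X^(p - q) * char_poly (C *m B).
Proof.
move=> le_qp; apply: (monic_lreg (monicXn R q)).
rewrite mulrA -exprD subnKC // /char_poly /char_poly_mx !map_mxM.
exact: det_scalar_sub_mulmxC.
Qed.

Lemma horner_char_poly (R : comNzRingType) (p : nat) (A : 'M[R]_p) (a : R) :
  (char_poly A).[a] = \det (a%:M - A).
Proof.
rewrite -horner_evalE -det_map_mx; congr (\det _); apply/matrixP => i j.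
rewrite !mxE /= horner_evalE hornerD hornerN hornerC hornerMn hornerX.
by [].
Qed.

(** The arcs lying over an edge are an arc and its reverse, which differ
    because there are no loops. *)
Lemma card_arcs_edges (G : sgraph) : #|arcs G| = (2 * #|edges G|)%N.
Proof.
pose ends (p : G * G) := [set p.1; p.2].
rewrite -sum1_card (partition_big ends [in edges G]) /=; last first.
  by move=> p; rewrite inE => Gp; apply: imset_f; rewrite inE.
rewrite mulnC -sum_nat_const; apply: eq_bigr => _
  /imsetP[[u v] /[!inE]/= Guv ->].
have neq_uv : u != v.
  by apply: contraTneq Guv => ->; rewrite adj_irrefl.
have neq_arcs : (u, v) != (v, u) by rewrite xpair_eqE negb_and neq_uv.
have -> : 2%N = #|[set (u, v); (v, u)]| by rewrite cards2 neq_arcs.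
rewrite -sum1_card; apply: eq_bigl => -[x y] /=.
rewrite !inE /ends /= !xpair_eqE; apply/andP/idP => [[Gxy /eqP xy_uv]|].
  have neq_xy : x != y by apply: contraTneq Gxy => ->; rewrite adj_irrefl.
  have : x \in [set u; v] by rewrite -xy_uv set21.
  have : y \in [set u; v] by rewrite -xy_uv set22.
  rewrite !inE => /orP[]/eqP eq_y /orP[]/eqP eq_x;
    by move: neq_xy; rewrite eq_x eq_y !eqxx ?orbT.
case/orP=> /andP[/eqP-> /eqP->]; first by [].
by rewrite adj_sym setUC eqxx.
Qed.

Lemma card_arcs_regular (G : sgraph) (d : nat) :
  regular G d -> #|arcs G| = (#|G| * d)%N.
Proof.
move=> regG; rewrite -sum1_card (eq_bigl (fun p : G * G => adj p.1 p.2)).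
  rewrite -(pair_big_dep xpredT (@adj G) (fun _ _ => 1%N)) /=.
  rewrite -sum_nat_const; apply: eq_bigr => x _.
  by rewrite sum1dep_card regG.
by move=> p; rewrite inE.
Qed.

Definition terminus_mx (R : nzRingType) (G : sgraph) : 'M[R]_(#|arcs G|, #|G|) :=
  \matrix_(i, j) (arc_terminus (enum_val i) == enum_val j)%:R.

Definition origin_mx (R : nzRingType) (G : sgraph) : 'M[R]_(#|G|, #|arcs G|) :=
  \matrix_(i, j) (arc_origin (enum_val j) == enum_val i)%:R.

Lemma crw_mxE (R : fieldType) (G : sgraph) (d : nat) :
  crw_mx R G d = (d%:R^-1 *: terminus_mx R G) *m origin_mx R G.
Proof.
apply/matrixP => i j; rewrite !mxE.
rewrite (bigD1 (enum_rank (arc_terminus (enum_val i)))) //= big1 => [|k neq_k].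
  rewrite !mxE enum_rankK eqxx mulr1 addr0 eq_sym.
  by case: eqP; rewrite ?mulr1 ?mulr0.
rewrite !mxE; case: eqP => [eq_k|]; last by rewrite mulr0 mul0r.
by rewrite eq_k enum_valK eqxx in neq_k.
Qed.

(** A simple graph has at most one arc from u to v, namely the pair (u, v). *)
Lemma adjacency_mxE (R : nzRingType) (G : sgraph) :
  adjacency_mx R G = origin_mx R G *m terminus_mx R G.
Proof.
apply/matrixP => i j; rewrite !mxE.
under eq_bigr => k _ do rewrite !mxE -natrM mulnb.
rewrite -(big_enum_val (fun p : G * G =>
  ((arc_origin p == enum_val i) && (arc_terminus p == enum_val j))%:R)) /=.
rewrite -natr_sum; congr (_%:R).
have [Gij | nGij] := boolP (adj (enum_val i) (enum_val j)).
  rewrite (bigD1 (enum_val i, enum_val j)) /= ?inE // !eqxx big1 // => -[u v].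
  by rewrite xpair_eqE => /andP[_ /negPf->].
rewrite big1 // => -[u v] /=; rewrite inE /= => Guv.
by case: andP => // -[/eqP eq_u /eqP eq_v]; rewrite -eq_u -eq_v Guv in nGij.
Qed.

Theorem theorem8 (R : numFieldType) (G : sgraph) (d n m : nat)
    (hd : (2 <= d)%N) (hconn : connected G) (hreg : regular G d)
    (hn : #|G| = n) (hm : #|edges G| = m) (lambda : R) :
  \det (lambda%:M - crw_mx R G d)
  = lambda ^+ (2 * m - n) * \det (lambda%:M - d%:R^-1 *: adjacency_mx R G).
Proof.
have le_n_arcs : (#|G| <= #|arcs G|)%N.
  by rewrite (card_arcs_regular _ _ hreg) leq_pmulr // ltnW.
rewrite -hn -hm -card_arcs_edges -!horner_char_poly crw_mxE.
rewrite char_poly_mulmxC // hornerM hornerXn.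
by rewrite -scalemxAr adjacency_mxE.
Qed.
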